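(* Let $p_t\in\mathbb{N}_0$ be even. For $\omega_t,\alpha,\theta_t\in\mathbb{R}$ let $\hat{\mathcal S}(\omega_t,\alpha,\theta_t)\ge 0$ be defined by $$\big(\hat{\mathcal S}(\omega_t,\alpha,\theta_t)\big)^2 := (1-\omega_t)^2+2\omega_t(1-\omega_t)\,\alpha\cos(\theta_t)+\alpha^2\omega_t^2 ,$$ and let $\alpha(\theta_x,\mu):=R(-\mu\,\beta(\theta_x))$, with $R$ and $\beta$ as in the context. Then for every $\mu\ge 0$ $$\inf_{\omega_t\in(0,1]}\ \sup_{\theta_t\in[\frac{\pi}{2},\pi],\ \theta_x\in[0,\pi]}\hat{\mathcal S}(\omega_t,\alpha(\theta_x,\mu),\theta_t)=\frac{1}{\sqrt2},$$ with the optimal parameters $\omega_t^\ast=\frac12$, $\theta_t^\ast=\frac{\pi}{2}$ and $\theta_x^\ast=0$; that is, the infimum is attained at $\omega_t^\ast=\frac12$, and the supremum is attained at $(\theta_t,\theta_x)=(\theta_t^\ast,\theta_x^\ast)$.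
   Context: $R(z)$ is the $(p_t,p_t+1)$ subdiagonal Pad\'e approximation of $e^z$, i.e. the rational function $R=P/Q$ with $\deg P\le p_t$, $\deg Q\le p_t+1$, $Q(0)=1$ and $e^z-R(z)=O(z^{2p_t+2})$ as $z\to0$. The function $\beta$ is $\beta(\theta_x):=6\,\dfrac{1-\cos(\theta_x)}{2+\cos(\theta_x)}\in[0,12]$. The quantity defining $\hat{\mathcal S}^2$ equals $|1-\omega_t+e^{-\mathrm{i}\theta_t}\omega_t\alpha|^2$ and is therefore nonnegative. *)

(* Defs.v *)
From HB Require Import structures.
From mathcomp Require Import all_boot all_order all_algebra.
From mathcomp Require Import all_classical all_reals all_analysis.
From mathcomp Require Import ring lra.

Set Implicit Arguments.
Unset Strict Implicit.
Unset Printing Implicit Defensive.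

Import Order.TTheory GRing.Theory Num.Theory.
Import numFieldNormedType.Exports.

Local Open Scope classical_set_scope.
Local Open Scope ring_scope.

Definition ratfun (R : realType) (P Q : {poly R}) (z : R) : R := P.[z] / Q.[z].

(* P / Q is the (p, p + 1) Pade approximation of exp; sizes are degrees plus
   one. The approximation is determined by its Taylor series at 0 and has real
   coefficients, so real polynomials and a real variable z suffice. *)
Definition subdiag_pade (R : realType) (p : nat) (P Q : {poly R}) : Prop :=
  [/\ (size P <= p.+1)%N,
      (size Q <= p.+2)%N,
      Q.[0] = 1 &
      (fun z : R => expR z - ratfun P Q z)
        =O_ (nbhs (0 : R)) (fun z : R => z ^+ (2 * p + 2))].

Definition beta (R : realType) (thetax : R) : R :=
  6 * ((1 - cos thetax) / (2 + cos thetax)).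

Definition alpha (R : realType) (P Q : {poly R}) (thetax mu : R) : R :=
  ratfun P Q (- mu * beta thetax).

Definition Shat_sq (R : realType) (omega a thetat : R) : R :=
  (1 - omega) ^+ 2 + 2 * omega * (1 - omega) * a * cos thetat
  + a ^+ 2 * omega ^+ 2.

Definition Shat (R : realType) (omega a thetat : R) : R :=
  Num.sqrt (Shat_sq omega a thetat).

(* The two sides of the equation are |1 - omega + e^(- i thetat) omega a| ^ 2,
   so that the square root in [Shat] is never truncated. *)
Lemma Shat_sqE (R : realType) (omega a thetat : R) :
  Shat_sq omega a thetat =
  (1 - omega + omega * a * cos thetat) ^+ 2 + (omega * a * sin thetat) ^+ 2.
Proof.
rewrite /Shat_sq [in RHS]exprMn.
have -> : sin thetat ^+ 2 = 1 - cos thetat ^+ 2.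
  by rewrite -(cos2Dsin2 thetat) addrC addKr.
ring.
Qed.

Lemma Shat_spec (R : realType) (omega a thetat : R) :
  0 <= Shat omega a thetat /\
  Shat omega a thetat ^+ 2 = Shat_sq omega a thetat.
Proof.
split; first exact: sqrtr_ge0.
by rewrite sqr_sqrtr // Shat_sqE addr_ge0 // sqr_ge0.
Qed.

(* Extended-real valued, since [sup] on R is a default value on unbounded
   sets. *)
Definition sup_Shat (R : realType) (P Q : {poly R}) (mu omega : R) : \bar R :=
  ereal_sup [set (Shat omega (alpha P Q thetax mu) thetat)%:E |
             thetat in `[pi / 2, pi] & thetax in `[0, pi]].

(* Main.v *)
(** Let R = P / Q. If 0 <= R <= 1 on the negative half-line, then
    Shat ^ 2 <= (1 - omega) ^ 2 + omega ^ 2, because cos thetat <= 0, with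
    equality at thetat = pi / 2 and R = 1, which is reached at thetax = 0; the
    right-hand side is minimal at omega = 1 / 2.

    To bound R, write the Pade condition as P e^-z - Q = O(z^(2p+2)) and
    differentiate p + 2 times: Q disappears, and (1 - D)^(p+2) P = c z^p.
    Similarly q(z) = Q(-z) satisfies (1 - D)^(p+1) q = c' z^(p+1). Inverting
    1 - D on coefficients gives those of P and q explicitly; they satisfy
    0 <= P_j <= q_j, so that |P(x)| <= Q(x) for x <= 0. Finally (1 - D)^-1
    preserves nonnegativity on the real line, so P >= 0 when p is even. *)

Require Import Defs.
From HB Require Import structures.
From mathcomp Require Import all_boot all_order all_algebra.
From mathcomp Require Import all_classical all_reals all_analysis.
From mathcomp Require Import ring lra zify.

Import Order.TTheory GRing.Theory Num.Theory.
Import numFieldNormedType.Exports.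

Local Open Scope classical_set_scope.
Local Open Scope ring_scope.

(** * The operator 1 - D on polynomials and its inverse on monomials *)

(** This is -D conjugated by e^-z: (e^-z g)' = - e^-z (g - g'). *)
Definition oneBderiv {R : nzRingType} (g : {poly R}) : {poly R} := g - g^`().

Lemma size_oneBderiv (R : nzRingType) (g : {poly R}) :
  size (oneBderiv g) = size g.
Proof.
have [->|g0] := eqVneq g 0; first by rewrite /oneBderiv linear0 subrr.
by rewrite size_polyDl // size_polyN lt_size_deriv.
Qed.

Lemma size_iter_oneBderiv (R : nzRingType) (k : nat) (g : {poly R}) :
  size (iter k oneBderiv g) = size g.
Proof. by elim: k => //= k IH; rewrite size_oneBderiv. Qed.

Lemma dvdXn_deriv (R : fieldType) (n : nat) (p : {poly R}) :
  'X^(n.+1) %| p -> 'X^n %| p^`().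
Proof.
move=> /dvdpP[q ->].
rewrite derivM derivXn /= exprS mulrA dvdp_add ?dvdp_mull //.
by rewrite -mulr_natl !dvdp_mull.
Qed.

(* [T + T'] is small when [T] is a truncation of [exp (- z)]; then
   differentiating [A T - B] and changing sign gives [(A - A') T + B'] up to a
   small term. *)
Lemma dvdXn_iter_oneBderiv (R : fieldType) (T : {poly R}) (m n : nat)
    (A B : {poly R}) :
  (size B <= m)%N -> 'X^((n + m).-1) %| T + T^`() -> 'X^(n + m) %| A * T - B ->
  'X^n %| iter m oneBderiv A * T.
Proof.
elim: m A B => [|m IH] A B.
  by rewrite leqn0 size_poly_eq0 addn0 => /eqP-> _; rewrite subr0.
rewrite addnS /= => sB dT dAB; rewrite -iterS iterSr; apply: (IH _ (- B^`())).
- rewrite size_polyN; have [->|B0] := eqVneq B 0.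
    by rewrite linear0 size_poly0.
  by rewrite -ltnS (leq_trans (lt_size_deriv B0)).
- by apply: dvdp_trans dT; rewrite dvdp_exp2l ?leq_pred.
have -> : oneBderiv A * T - - B^`() = A * (T + T^`()) - (A * T - B)^`().
  by rewrite derivB derivM /oneBderiv; ring.
by rewrite dvdp_sub ?dvdp_mull // dvdXn_deriv.
Qed.

(** [T] is coprime to ['X], so ['X^n] divides (1 - D)^m A itself. As 1 - D preserves the degree,
    which is at most n, the quotient is a constant. *)
Lemma iter_oneBderiv_monomial (R : fieldType) (T A B : {poly R}) (m n : nat) :
  (size A <= n.+1)%N -> (size B <= m)%N -> T.[0] != 0 ->
  'X^((n + m).-1) %| T + T^`() -> 'X^(n + m) %| A * T - B ->
  exists c, iter m oneBderiv A = c *: 'X^n.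
Proof.
move=> sA sB T0 dT dAB.
have := dvdXn_iter_oneBderiv _ _ _ _ _ _ sB dT dAB.
rewrite Gauss_dvdpl; last first.
  by rewrite coprimep_expl // -['X]subr0 -[0]polyC0 coprimep_sym coprimep_XsubC.
move=> /dvdpP[q e]; have [q0|q0] := eqVneq q 0.
  by exists 0; rewrite e q0 mul0r scale0r.
have : (size q <= 1)%N.
  have := size_iter_oneBderiv _ m A; rewrite e size_mulXn //.
  by move=> /eqP; rewrite -(leq_add2l n) addn1 => /eqP ->.
by move=> /size1_polyC qE; exists q`_0; rewrite e {1}qE mul_polyC.
Qed.

(** On the coefficients scaled by j!, D acts as a shift, hence 1 - D as a difference. *)
Lemma coef_oneBderiv_fact (R : comNzRingType) (g : {poly R}) (j : nat) :
  (oneBderiv g)`_j * j`!%:R = g`_j * j`!%:R - g`_j.+1 * j.+1`!%:R.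
Proof.
by rewrite coefB coef_deriv -[_ *+ j.+1]mulr_natr factS natrM mulrBl mulrA.
Qed.

(** The binomials are the coefficients of (1 - D)^-k as a power series in D. Undoing one more factor
    sums them by Pascal's rule, starting from the top coefficient i = 0. *)
Lemma coef_iter_oneBderiv (R : comNzRingType) (k n i : nat) (c : R)
    (g : {poly R}) :
  iter k oneBderiv g = c *: 'X^n -> (i <= n)%N ->
  g`_(n - i) * (n - i)`!%:R = c * n`!%:R * 'C((k + i).-1, i)%:R.
Proof.
elim: k g i => [|k IH] g i.
  move=> /= -> ilen; rewrite coefZ coefXn add0n.
  case: i ilen => [|i] ilen; first by rewrite subn0 eqxx bin0 !mulr1.
  rewrite bin_small ?leqnn // mulr0.
  have -> : (n - i.+1 == n)%N = false by lia.
  by rewrite mulr0 mul0r.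
move=> e; rewrite iterSr in e; have {}IH := fun i => IH _ i e.
have sg : (size g <= n.+1)%N.
  rewrite -(size_oneBderiv _ g) -(size_iter_oneBderiv _ k) e.
  by rewrite (leq_trans (size_scale_leq _ _)) ?size_polyXn.
elim: i => [|i IHi] ilen.
  have := coef_oneBderiv_fact _ g n.
  rewrite [g`_n.+1]nth_default // mul0r subr0.
  by have := IH 0%N ilen; rewrite !subn0 !bin0 => -> ->.
have := coef_oneBderiv_fact _ g (n - i.+1); rewrite IH //.
have -> : (n - i.+1).+1 = (n - i)%N by lia.
rewrite IHi 1?ltnW // => /eqP; rewrite eq_sym subr_eq => /eqP ->.
by rewrite -mulrDr -natrD !addSn !addnS /= -binS.
Qed.

(** * Taylor polynomials of e^-z *)

Definition expN_trunc {R : fieldType} (n : nat) : {poly R} :=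
  \poly_(i < n) ((-1) ^+ i / i`!%:R).

Lemma horner0_expN_trunc (R : fieldType) (n : nat) :
  (expN_trunc n.+1).[0] = 1 :> R.
Proof. by rewrite horner_coef0 coef_poly /= expr0 fact0 divr1. Qed.

Lemma deriv_expN_trunc (R : numFieldType) (n : nat) :
  (expN_trunc n.+1)^`() = - expN_trunc n :> {poly R}.
Proof.
apply/polyP => i; rewrite coef_deriv coefN !coef_poly ltnS.
case: ifP => _; last by rewrite mul0rn oppr0.
rewrite factS natrM invfM exprS -mulr_natr.
have : i.+1%:R != 0 :> R by rewrite pnatr_eq0.
have : i`!%:R != 0 :> R by rewrite pnatr_eq0 -lt0n fact_gt0.
by move=> ? ?; field; apply/andP.
Qed.

(** The sum telescopes: only the top monomial of the truncation survives. *)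
Lemma dvdXn_expN_trunc (R : numFieldType) (n : nat) :
  'X^n %| (expN_trunc n.+1 + (expN_trunc n.+1)^`() : {poly R}).
Proof.
rewrite deriv_expN_trunc /expN_trunc !poly_def big_ord_recr /= addrAC subrr.
by rewrite add0r -mul_polyC dvdp_mull.
Qed.

(** The derivative of each remainder is minus the previous remainder, so the mean value theorem
    gains one factor |x| per induction step. The constant e bounds e^-x when n = 0. *)
Lemma expRN_taylor (R : realType) (n : nat) (x : R) : `|x| <= 1 ->
  `|expR (- x) - (expN_trunc n).[x]| <= expR 1 * `|x| ^+ n.
Proof.
have drv m y : is_derive y (1 : R) (fun z => expR (- z) - (expN_trunc m.+1).[z])
    (- (expR (- y) - (expN_trunc m).[y])).
  have h : is_derive y (1 : R) (expR \o -%R) (- expR (- y)).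
    by apply: is_derive_eq; rewrite mulrN1.
  have k := is_derive_poly (expN_trunc m.+1) y.
  apply: (is_derive_eq (is_deriveB h k)).
  by rewrite deriv_expN_trunc hornerN opprB opprK addrC.
elim: n x => [|n IH] x x1.
  rewrite /expN_trunc poly_def big_ord0 horner0 subr0 expr0 mulr1.
  rewrite ger0_norm ?expR_ge0 //.
  by rewrite ler_expR; move: x1; rewrite ler_norml lerNl => /andP[].
pose f (z : R) := expR (- z) - (expN_trunc n.+1).[z].
have f0 : f 0 = 0 by rewrite /f oppr0 expR0 horner0_expN_trunc subrr.
have cf a b : {within `[a, b], continuous f}.
  apply: derivable_within_continuous => y _.
  by have [] := drv n y.
have [c cx fx] : exists2 c,
    `|c| <= `|x| & f x = - (expR (- c) - (expN_trunc n).[c]) * x.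
  have [x0|x0] := leP 0 x.
    have [c] := @MVT_segment R f _ 0 x x0 (fun y _ => drv n y) (cf 0 x).
    rewrite f0 !subr0 in_itv /= => /andP[c0 cx] ->.
    by exists c => //; rewrite !ger0_norm.
  have [c] := @MVT_segment R f _ x 0 (ltW x0) (fun y _ => drv n y) (cf x 0).
  rewrite f0 sub0r in_itv /= => /andP[xc c0] fx.
  exists c; last by rewrite -[LHS]opprK fx; ring.
  by rewrite !ler0_norm ?lerN2 // ltW.
rewrite -/(f x) fx normrM normrN exprSr mulrA ler_wpM2r //.
apply: le_trans (IH c (le_trans cx x1)) _.
by rewrite ler_wpM2l ?expR_ge0 // lerXn2r ?nnegrE.
Qed.

(** * Real estimates for polynomials: divisibility by powers of ['X], and positivity *)

Lemma horner_norm_le (R : realType) (p : {poly R}) (M z : R) (n : nat) :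
  1 <= M -> `|z| <= M -> (size p <= n)%N ->
  `|p.[z]| <= (\sum_(i < size p) `|p`_i|) * M ^+ n.
Proof.
move=> M1 zM sp; rewrite horner_coef mulr_suml.
apply: le_trans (ler_norm_sum _ _ _) _; apply: ler_sum => i _.
rewrite normrM ler_wpM2l // normrX.
apply: (@le_trans _ _ (M ^+ i)).
  by rewrite lerXn2r ?nnegrE // (le_trans ler01).
by rewrite ler_weXn2l // ltnW // (leq_trans _ sp).
Qed.

Lemma dvdXn_small (R : realType) (N : nat) (p : {poly R}) (C d : R) :
  0 < d -> (forall z, 0 < `|z| < d -> `|p.[z]| <= C * `|z| ^+ N) ->
  'X^N %| p.
Proof.
move=> d0; elim: N p => [|N IH] p H; first by rewrite expr0 dvd1p.
have [q pE] : exists q : {poly R}, p = q * 'X + (p`_0)%:P.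
  exists (drop_poly 1 p); rewrite -[LHS](poly_take_drop 1) addrC; congr (_ + _).
  by apply/polyP => -[|i]; rewrite coefC coef_take_poly.
pose L := \sum_(i < size q) `|q`_i|.
have L0 : 0 <= L by apply: sumr_ge0.
have p0 : p`_0 = 0.
  apply/eqP; apply/negP => /negP; rewrite -normr_gt0 => c0.
  pose e := Num.min 1 d / 2.
  have m0 : 0 < Num.min 1 d by rewrite lt_min ltr01.
  have D0 : 0 < 2 * (`|C| + L + 1).
    by rewrite mulr_gt0 // ltr_wpDl // addr_ge0.
  pose z := Num.min e (`|p`_0| / (2 * (`|C| + L + 1))).
  have z0 : 0 < z by rewrite lt_min !divr_gt0.
  have ze : z <= e by rewrite ge_min lexx.
  have ed : e < d.
    have : Num.min 1 d <= d by rewrite ge_min lexx orbT.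
    by rewrite /e; lra.
  have e1 : e <= 1.
    have : Num.min 1 d <= 1 by rewrite ge_min lexx.
    by rewrite /e; lra.
  have z1 : z <= 1 by exact: le_trans e1.
  have zc : z * (2 * (`|C| + L + 1)) <= `|p`_0|.
    by rewrite -ler_pdivlMr // ge_min lexx orbT.
  have nz : `|z| = z by rewrite gtr0_norm.
  have := H z; rewrite nz z0 (le_lt_trans ze ed) => /(_ isT) Hp.
  have qz : `|q.[z]| <= L.
    have := @horner_norm_le R q 1 z (size q) (lexx _).
    by rewrite nz expr1n mulr1; apply.
  have : `|p`_0| <= (`|C| + L) * z.
    have -> : p`_0 = p.[z] - q.[z] * z.
      by rewrite [in p.[_]]pE !hornerE addrC addKr.
    apply: le_trans (ler_normB _ _) _; rewrite mulrDl lerD //; last first.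
      by rewrite normrM nz ler_wpM2r // ltW.
    apply: le_trans Hp _; rewrite exprS mulrA.
    apply: (@le_trans _ _ (`|C| * z * z ^+ N)).
      by rewrite ler_wpM2r ?exprn_ge0 ?ler_wpM2r ?ler_norm // ltW.
    by rewrite ler_piMr ?mulr_ge0 ?exprn_ile1 // ltW.
  by nra.
rewrite pE p0 addr0 exprSr dvdp_mul2r ?polyX_eq0 //.
apply: IH => z zd; have /andP[z0 _] := zd.
have := H z zd; rewrite pE p0 addr0 !hornerE normrM exprSr mulrA.
by rewrite ler_pM2r.
Qed.

(** Replacing e^-z by its truncation costs only O(z^N), which turns the analytic estimate into a
    divisibility between polynomials. *)
Lemma dvdXn_taylor (R : realType) (N : nat) (A B : {poly R}) (C d : R) :
  0 < d ->
  (forall z, `|z| < d -> `|A.[z] * expR (- z) - B.[z]| <= C * `|z| ^+ N) ->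
  'X^N %| A * expN_trunc N - B.
Proof.
set T := expN_trunc N => d0 H.
pose K := \sum_(i < size A) `|A`_i|.
apply: (@dvdXn_small _ _ _ (C + K * expR 1) (Num.min d 1)).
  by rewrite lt_min d0 ltr01.
move=> z /andP[_]; rewrite lt_min => /andP[zd z1]; have {}z1 := ltW z1.
have -> : (A * T - B).[z] =
    A.[z] * expR (- z) - B.[z] - A.[z] * (expR (- z) - T.[z]).
  by rewrite !hornerE; ring.
apply: le_trans (ler_normB _ _) _; rewrite mulrDl lerD ?H // normrM -mulrA.
rewrite ler_pM //; last exact: expRN_taylor.
have := @horner_norm_le R A 1 z (size A) (lexx _) z1.
by rewrite expr1n mulr1; apply.
Qed.

(* [exp (- z) g] is nonincreasing and tends to 0 at infinity. *)
Lemma oneBderiv_ge0 (R : realType) (g : {poly R}) :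
  (forall z, 0 <= (oneBderiv g).[z]) -> forall z, 0 <= g.[z].
Proof.
move=> H a; rewrite leNgt; apply/negP => ga.
pose h z := g.[z] * expR (- z).
have drv y : is_derive y (1 : R) h (- ((oneBderiv g).[y] * expR (- y))).
  have k : is_derive y (1 : R) (expR \o -%R) (- expR (- y)).
    by apply: is_derive_eq; rewrite mulrN1.
  apply: (is_derive_eq (is_deriveM (is_derive_poly g y) k)).
  by rewrite /GRing.scale /= !hornerE; ring.
pose K := \sum_(i < size g) `|g`_i|.
pose n := size g.
pose eta := - h a.
have eta0 : 0 < eta by rewrite oppr_gt0 pmulr_llt0 ?expR_gt0.
have K0 : 0 <= K by apply: sumr_ge0.
(* Monotonicity gives eta e^z <= K z^n. This z is large enough to contradict it through e^z >= 1 +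
   z^(n+1) / (n+1)!. *)
pose z := 1 + `|a| + K * n.+1`!%:R / eta.
have q0 : 0 <= K * n.+1`!%:R / eta by rewrite divr_ge0 ?mulr_ge0 // ltW.
have z1 : 1 <= z by rewrite /z -addrA ler_wpDr // addr_ge0.
have z0 : 0 < z by exact: lt_le_trans z1.
have az : a <= z.
  by rewrite /z; have := ler_norm a; lra.
have hz : h z <= - eta.
  have [] := @MVT_segment R h _ a z az (fun y _ => drv y).
    apply: derivable_within_continuous => y _.
    by have [] := drv y.
  move=> c _; rewrite /eta opprK => e; rewrite -subr_le0 e mulNr oppr_le0.
  by rewrite !mulr_ge0 ?expR_ge0 ?subr_ge0.
have : eta * expR z <= K * z ^+ n.
  have : eta <= - h z by rewrite lerNr.
  rewrite -(@ler_pM2r _ (expR z)) ?expR_gt0 // => /le_trans; apply.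
  rewrite /h mulNr -mulrA [expR (- z) * _]mulrC expRxMexpNx_1 mulr1.
  apply: le_trans (@horner_norm_le R g z z n z1 _ (leqnn _)).
    by rewrite -normrN ler_norm.
  by rewrite gtr0_norm.
apply/negP; rewrite -ltNge.
apply: lt_le_trans (_ : eta * (1 + z ^+ n.+1 / n.+1`!%:R) <= _); last first.
  by rewrite ler_pM2l // expR_ge1Dxn // ltW.
have f0 : 0 < n.+1`!%:R :> R by rewrite ltr0n fact_gt0.
rewrite mulrDr mulr1 ltr_pwDl //.
rewrite mulrA ler_pdivlMr // exprS mulrA mulrAC.
rewrite ler_wpM2r ?exprn_ge0 ?(ltW z0) //.
rewrite [eta * z]mulrC -ler_pdivrMr //.
by rewrite /z; have := normr_ge0 a; lra.
Qed.

Lemma iter_oneBderiv_ge0 (R : realType) (k : nat) (g : {poly R}) :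
  (forall z, 0 <= (iter k oneBderiv g).[z]) -> forall z, 0 <= g.[z].
Proof. by elim: k => // k IH H; apply: IH; apply: oneBderiv_ge0. Qed.

(** * The Pade condition, cleared of denominators and differentiated *)

Lemma pade_remainder (R : realType) (p : nat) (P Q : {poly R}) :
  subdiag_pade p P Q ->
  exists C d, 0 < d /\ forall z, `|z| < d ->
    `|Q.[z] * expR z - P.[z]| <= C * `|z| ^+ (2 * p + 2).
Proof.
move=> [_ _ Q0 /eqO_exP[C C0 HC]].
(* Clearing the denominator requires Q(z) to be nonzero, which holds near 0 because Q(0) = 1. *)
have HQ : \forall z \near (0 : R), Q.[z] != 0.
  apply: (@cvgr_neq0 _ _ _ (nbhs (0 : R)) _ (horner Q) Q.[0]).
    exact: continuous_horner.
  by rewrite Q0 oner_neq0.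
have [d /= d0 Hd] : exists2 d : R, 0 < d & forall z, `|z| < d -> Q.[z] != 0 /\
    `|expR z - ratfun P Q z| <= C * `|z| ^+ (2 * p + 2).
  have : nbhs (0 : R) [set z | Q.[z] != 0 /\
      `|expR z - ratfun P Q z| <= C * `|z ^+ (2 * p + 2)|] by exact: filterI.
  move=> /nbhs_ballP[d /= d0 Hd].
  exists d => // z zd; have [|? H] := Hd z; last by rewrite -normrX.
  by rewrite /ball /= sub0r normrN.
pose K := \sum_(i < size Q) `|Q`_i|.
exists (K * C), (Num.min d 1); split; first by rewrite lt_min d0 ltr01.
move=> z; rewrite lt_min => /andP[zd z1]; have [Qz H] := Hd z zd.
have -> : Q.[z] * expR z - P.[z] = Q.[z] * (expR z - ratfun P Q z).
  by rewrite /ratfun mulrBr [Q.[z] * (_ / _)]mulrC mulfVK.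
rewrite normrM -mulrA ler_pM //.
have := @horner_norm_le R Q 1 z (size Q) (lexx _) (ltW z1).
by rewrite expr1n mulr1; apply.
Qed.

Lemma horner_reflect (R : comNzRingType) (p : {poly R}) (x : R) :
  (p \Po - 'X).[x] = p.[- x].
Proof. by rewrite horner_comp hornerN hornerX. Qed.

Lemma size_reflect (R : idomainType) (p : {poly R}) :
  size (p \Po - 'X) = size p.
Proof. by rewrite size_comp_poly2 // size_polyN size_polyX. Qed.

Lemma pade_numer_oneBderiv (R : realType) (p : nat) (P Q : {poly R}) :
  subdiag_pade p P Q -> exists c, iter p.+2 oneBderiv P = c *: 'X^p.
Proof.
move=> padePQ; have [sP sQ _ _] := padePQ.
have [C [d [d0 H]]] := pade_remainder _ _ _ _ padePQ.
apply: (iter_oneBderiv_monomial _ (expN_trunc (2 * p + 2)) _ Q) => //.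
- by rewrite addn2 horner0_expN_trunc oner_neq0.
- have -> : (p + p.+2).-1 = (2 * p).+1 by lia.
  by rewrite addn2 dvdXn_expN_trunc.
have -> : (p + p.+2 = 2 * p + 2)%N by lia.
(* The remainder is multiplied by - e^-z, which is at most e in absolute value when |z| < 1. *)
apply: (@dvdXn_taylor _ _ _ _ (expR 1 * C) (Num.min d 1)).
  by rewrite lt_min d0 ltr01.
move=> z; rewrite lt_min => /andP[zd z1].
have -> : P.[z] * expR (- z) - Q.[z] = - expR (- z) * (Q.[z] * expR z - P.[z]).
  by rewrite mulrBr mulrCA mulNr [expR (- z) * expR z]mulrC expRxMexpNx_1; ring.
rewrite normrM normrN -mulrA ler_pM // ?H // ger0_norm ?expR_ge0 // ler_expR.
by rewrite (le_trans _ (ltW z1)) // -normrN ler_norm.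
Qed.

(** Substituting -z turns the remainder into Q(-z) e^-z - P(-z), so the numerator and denominator
    exchange roles. *)
Lemma pade_denom_oneBderiv (R : realType) (p : nat) (P Q : {poly R}) :
  subdiag_pade p P Q ->
  exists c, iter p.+1 oneBderiv (Q \Po - 'X) = c *: 'X^(p.+1).
Proof.
move=> padePQ; have [sP sQ _ _] := padePQ.
have [C [d [d0 H]]] := pade_remainder _ _ _ _ padePQ.
apply: (iter_oneBderiv_monomial _ (expN_trunc (2 * p + 2)) _ (P \Po - 'X)).
- by rewrite size_reflect.
- by rewrite size_reflect.
- by rewrite addn2 horner0_expN_trunc oner_neq0.
- have -> : (p.+1 + p.+1).-1 = (2 * p).+1 by lia.
  by rewrite addn2 dvdXn_expN_trunc.
have -> : (p.+1 + p.+1 = 2 * p + 2)%N by lia.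
apply: (@dvdXn_taylor _ _ _ _ C d) => // z zd.
by rewrite !horner_reflect -[`|z|]normrN H // normrN.
Qed.

Lemma pade_horner0 (R : realType) (p : nat) (P Q : {poly R}) :
  subdiag_pade p P Q -> P.[0] = 1.
Proof.
move=> padePQ; have [_ _ Q0 _] := padePQ.
have [C [d [d0 /(_ 0)]]] := pade_remainder _ _ _ _ padePQ.
rewrite normr0 addn2 expr0n mulr0 expR0 mulr1 Q0 => /(_ d0).
by rewrite normr_le0 subr_eq0 => /eqP.
Qed.

(** * Coefficients and bounds of the numerator and denominator *)

Lemma leq_bin_succ (m i : nat) : (i < m)%N ->
  ('C(m + i, i) <= 'C(m + i, i.+1))%N.
Proof.
move=> im; rewrite -(@leq_pmul2l i.+1) // mul_bin_left addnK.
by rewrite leq_mul2r im orbT.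
Qed.

(** Write q(z) = Q(-z). For j <= p and i = p - j, the numbers j! P_j and j! q_j are the same
    positive constant times C(p+1+i, i) and C(p+1+i, i+1). *)
Lemma pade_coef (R : realType) (p : nat) (P Q : {poly R}) (j : nat) :
  subdiag_pade p P Q -> 0 <= P`_j <= (Q \Po - 'X)`_j.
Proof.
move=> padePQ; have [sP sQ Q0 _] := padePQ.
have P0 := pade_horner0 _ _ _ _ padePQ.
have [c Pc] := pade_numer_oneBderiv _ _ _ _ padePQ.
have [c' Qc] := pade_denom_oneBderiv _ _ _ _ padePQ.
set q := Q \Po - 'X in Qc *.
have q0 : q.[0] = 1 by rewrite horner_reflect oppr0.
have fgt n : 0 < n`!%:R :> R by rewrite ltr0n fact_gt0.
have bgt m n : (n <= m)%N -> 0 < 'C(m, n)%:R :> R by rewrite ltr0n bin_gt0.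
have PE i : (i <= p)%N ->
    P`_(p - i) * (p - i)`!%:R = c * p`!%:R * 'C(p.+1 + i, i)%:R.
  by move=> ip; rewrite (coef_iter_oneBderiv _ _ _ _ _ _ Pc).
have qE i : (i <= p.+1)%N ->
    q`_(p.+1 - i) * (p.+1 - i)`!%:R = c' * p.+1`!%:R * 'C(p + i, i)%:R.
  by move=> ip; rewrite (coef_iter_oneBderiv _ _ _ _ _ _ Qc).
(* Compare the constant terms P(0) = q(0) = 1: the binomials C(2p+1, p) and C(2p+1, p+1) agree. *)
have kc : c * p`!%:R = c' * p.+1`!%:R.
  have := qE _ (leqnn _); have := PE _ (leqnn _).
  rewrite !subnn -!horner_coef0 P0 q0 => ->.
  have -> : 'C(p.+1 + p, p) = 'C(p + p.+1, p.+1).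
    by rewrite -bin_sub ?leq_addl // addnK addnC.
  by apply: mulIf; rewrite lt0r_neq0 // bgt // leq_addl.
have kgt : 0 < c * p`!%:R.
  have := PE _ (leqnn _); rewrite subnn -horner_coef0 P0 fact0 mulr1 => e.
  by rewrite -(@pmulr_lgt0 _ ('C(p.+1 + p, p)%:R)) ?bgt ?leq_addl // -e ltr01.
(* Above degree p only q has a coefficient, at j = p + 1. *)
have [jp|pj] := leqP j p; last first.
  rewrite nth_default ?(leq_trans sP) // lexx /=.
  have [->|jp] := eqVneq j p.+1; last first.
    rewrite nth_default // size_reflect (leq_trans sQ) //.
    by rewrite ltn_neqAle eq_sym jp.
  have := qE 0%N isT; rewrite subn0 bin0 mulr1 => e.
  by rewrite -(pmulr_lge0 _ (fgt p.+1)) e -kc ltW.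
have ip : (p - j <= p)%N by rewrite leq_subr.
have := PE _ ip; have := qE (p - j).+1 ip; rewrite subSS subKn // -kc => eq eP.
rewrite -(pmulr_lge0 _ (fgt j)) -[P`_j <= _](ler_pM2r (fgt j)) eP eq.
rewrite mulr_ge0 ?ler0n ?(ltW kgt) //= ler_pM2l // ler_nat.
by rewrite -addSnnS leq_bin_succ.
Qed.

Lemma pade_numer_le_denom (R : realType) (p : nat) (P Q : {poly R}) (x : R) :
  subdiag_pade p P Q -> x <= 0 -> `|P.[x]| <= Q.[x].
Proof.
move=> padePQ x0; have [sP sQ _ _] := padePQ.
have -> : Q.[x] = (Q \Po - 'X).[- x] by rewrite horner_reflect opprK.
rewrite (@horner_coef_wide _ p.+2) ?(leq_trans sP) //.
rewrite (@horner_coef_wide _ p.+2 (Q \Po _)) ?size_reflect //.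
apply: le_trans (ler_norm_sum _ _ _) _; apply: ler_sum => i _.
have /andP[P0 Pq] := pade_coef _ _ _ _ i padePQ.
rewrite normrM normrX (ler0_norm x0) (ger0_norm P0).
by rewrite ler_wpM2r // exprn_ge0 // oppr_ge0.
Qed.

Lemma pade_numer_ge0 (R : realType) (p : nat) (P Q : {poly R}) (x : R) :
  ~~ odd p -> subdiag_pade p P Q -> 0 <= P.[x].
Proof.
move=> pe padePQ; have [c Pc] := pade_numer_oneBderiv _ _ _ _ padePQ.
(* Since 1 - D preserves the leading term, c is the coefficient P_p, already known to be
   nonnegative. *)
have c0 : 0 <= c.
  have := coef_iter_oneBderiv _ _ _ 0 _ _ Pc isT.
  rewrite subn0 bin0 mulr1 => e; suff <- : P`_p = c.
    by have /andP[] := pade_coef _ _ _ _ p padePQ.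
  by apply: mulIf e; rewrite pnatr_eq0 -lt0n fact_gt0.
apply: (@iter_oneBderiv_ge0 _ p.+2) => z.
by rewrite Pc hornerZ hornerXn mulr_ge0 // exprn_even_ge0.
Qed.

Lemma pade_ratfun_itv (R : realType) (p : nat) (P Q : {poly R}) (x : R) :
  ~~ odd p -> subdiag_pade p P Q -> x <= 0 -> 0 <= ratfun P Q x <= 1.
Proof.
move=> pe padePQ x0; rewrite /ratfun.
have P0 := pade_numer_ge0 _ _ _ _ x pe padePQ.
have := pade_numer_le_denom _ _ _ _ x padePQ x0; rewrite ger0_norm // => PQ.
have Q0 := le_trans P0 PQ.
(* At a zero of Q the quotient is 0 by the convention on inverses. *)
rewrite divr_ge0 //=; have [->|Qn] := eqVneq Q.[x] 0.
  by rewrite invr0 mulr0.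
by rewrite ler_pdivrMr ?mul1r // lt_def Qn.
Qed.

(** * The supremum over the angles and the infimum over omega *)

Lemma beta_ge0 (R : realType) (t : R) : 0 <= beta t.
Proof.
have := cos_le1 t; have := cos_geN1 t => c1 c2.
by rewrite /beta mulr_ge0 // divr_ge0 //; lra.
Qed.

Lemma Shat_pi2 (R : realType) (omega : R) :
  Shat omega 1 (pi / 2) = Num.sqrt ((1 - omega) ^+ 2 + omega ^+ 2).
Proof. by rewrite /Shat /Shat_sq cos_pihalf mulr0 addr0 expr1n mul1r. Qed.

Lemma cos_le0 (R : realType) (t : R) : pi / 2 <= t <= pi -> cos t <= 0.
Proof.
move=> /andP[t1 t2].
have -> : t = (t - pi / 2) + pi / 2 by ring.
rewrite cosDpihalf oppr_le0 sin_ge0_pi //.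
by have := pi_ge0 R; lra.
Qed.

Lemma Shat_le (R : realType) (omega a t : R) :
  0 < omega <= 1 -> 0 <= a <= 1 -> cos t <= 0 ->
  Shat omega a t <= Num.sqrt ((1 - omega) ^+ 2 + omega ^+ 2).
Proof.
move=> /andP[w0 w1] /andP[a0 a1] ct.
rewrite /Shat ler_wsqrtr // /Shat_sq -addrA.
rewrite lerD2l; apply: (@le_trans _ _ (a ^+ 2 * omega ^+ 2)).
  rewrite gerDr mulr_ge0_le0 // !mulr_ge0 ?subr_ge0 // ltW //.
by rewrite ler_piMl ?sqr_ge0 // exprn_ile1.
Qed.

Lemma sup_ShatE (R : realType) (pt : nat) (P Q : {poly R}) (mu omega : R) :
  ~~ odd pt -> subdiag_pade pt P Q -> 0 <= mu -> 0 < omega <= 1 ->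
  (Shat omega (alpha P Q 0 mu) (pi / 2))%:E = sup_Shat P Q mu omega /\
  sup_Shat P Q mu omega = (Num.sqrt ((1 - omega) ^+ 2 + omega ^+ 2))%:E.
Proof.
move=> pe padePQ mu0 w.
have a0 : alpha P Q 0 mu = 1.
  have [_ _ Q0 _] := padePQ.
  rewrite /alpha /beta cos0 subrr mul0r !mulr0 /ratfun Q0.
  by rewrite (pade_horner0 _ _ _ _ padePQ) divr1.
rewrite a0 Shat_pi2.
have -> : sup_Shat P Q mu omega = (Num.sqrt ((1 - omega) ^+ 2 + omega ^+ 2))%:E.
  apply/eqP; rewrite eq_le; apply/andP; split.
    apply: ge_ereal_sup => _ [t tI [x xI <-]]; rewrite lee_fin Shat_le //.
      apply: pade_ratfun_itv pe padePQ _.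
      by rewrite mulNr oppr_le0 mulr_ge0 // beta_ge0.
    by apply: cos_le0; move: tI; rewrite /= in_itv.
  (* The bound is a value of the family: beta(0) = 0 gives alpha = R(0) = 1 at thetax = 0. *)
  apply: ereal_sup_ubound; exists (pi / 2).
    by rewrite /= in_itv /= lexx /=; have := pi_ge0 R; lra.
  exists 0; first by rewrite /= in_itv /= lexx pi_ge0.
  by rewrite a0 Shat_pi2.
by [].
Qed.

Theorem lemma3p9 (R : realType) (pt : nat) (P Q : {poly R})
    (pt_even : ~~ odd pt) (padePQ : subdiag_pade pt P Q)
    (mu : R) (mu_ge0 : 0 <= mu) :
  [/\ ereal_inf [set sup_Shat P Q mu omega | omega in `]0, 1]]
        = (1 / Num.sqrt 2)%:E,
      sup_Shat P Q mu (1 / 2)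
        = ereal_inf [set sup_Shat P Q mu omega | omega in `]0, 1]] &
      forall omega : R, 0 < omega <= 1 ->
        (Shat omega (alpha P Q 0 mu) (pi / 2))%:E = sup_Shat P Q mu omega].
Proof.
have supE omega := @sup_ShatE R pt P Q mu omega pt_even padePQ mu_ge0.
have half : 0 < 1 / 2 :> R /\ (1 / 2 : R) <= 1 by split; lra.
have sup_half : sup_Shat P Q mu (1 / 2) = (1 / Num.sqrt 2)%:E.
  have [|_ ->] := supE (1 / 2); first by apply/andP.
  congr (_%:E); rewrite !div1r -sqrtrV ?ler0n //; congr Num.sqrt; by field.
have infE : ereal_inf [set sup_Shat P Q mu omega | omega in `]0, 1]]
    = (1 / Num.sqrt 2)%:E.
  apply/eqP; rewrite eq_le; apply/andP; split.
    rewrite -sup_half; apply: ereal_inf_lbound.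
    by exists (1 / 2) => //=; rewrite in_itv /=; apply/andP.
  apply: le_ereal_inf_tmp => _ [omega /= + <-]; rewrite in_itv /= => w.
  have [_ ->] := supE _ w; rewrite lee_fin.
  rewrite div1r -sqrtrV ?ler0n // ler_wsqrtr //.
  (* (1 - omega)^2 + omega^2 - 1/2 = (2 omega - 1)^2 / 2. *)
  by have := sqr_ge0 (2 * omega - 1); nra.
split=> //; first by rewrite infE.
by move=> omega /supE[].
Qed.
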